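(* Let $M_X=(X,\delta_X)$ be an $n$-point metric space, let $k\ge2$ be an integer, and let $G_X$ be a spanner for $M_X$ with $m$ edges, stretch $\beta$ and lightness $L$. Let $H_k$ be a $\gamma$-spanner for $M_X$ with hop-diameter $k$ and $O(n\alpha_k(n)\cdot\zeta)$ edges, equipped with a data structure $\mathcal{D}_X$ that, for any $u,v\in X$, returns in time $\tau$ a path in $H_k$ between $u$ and $v$ with at most $k$ edges and weight at most $\gamma\,\delta_X(u,v)$. Then one can, in $O(m\tau)$ time, transform $G_X$ into a spanner $G'_X$ for $M_X$ with stretch $\gamma\beta$, lightness $\gamma L$, and $O(n\alpha_k(n)\cdot\zeta)$ edges.
   Context: A spanner for $M_X$ is a subgraph $H$ of the complete graph on $X$ with edge weights $w(x,y)=\delta_X(x,y)$; its stretch is $\max_{u\ne v}\delta_H(u,v)/\delta_X(u,v)$; its lightness is $w(H)/w(\mathrm{MST}(M_X))$, where $w(H)$ is the total edge weight and $\mathrm{MST}(M_X)$ a minimum spanning tree of the metric. Hop-diameter $k$ means every pair is joined by a path with at most $k$ edges and weight at most $\gamma\,\delta_X(u,v)$. The functions $\alpha_k$: $A(0,n)=2n$; for $k\ge1$, $A(k,0)=1$, $A(k,n)=A(k-1,A(k,n-1))$; $B(0,n)=n^2$; for $k\ge1$, $B(k,0)=2$, $B(k,n)=B(k-1,B(k,n-1))$; $\alpha_{2k}(n)=\min\{s\ge0:A(k,s)\ge n\}$, $\alpha_{2k+1}(n)=\min\{s\ge0:B(k,s)\ge n\}$. The parameters $\gamma,\zeta,\tau$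 are arbitrary here (e.g. those given by tree covers). *)

(* Defs.v *)
From mathcomp Require Import all_boot all_order all_algebra.
From mathcomp Require Import all_classical all_reals ereal.
Set Implicit Arguments.
Unset Strict Implicit.
Unset Printing Implicit Defensive.
Import Order.TTheory GRing.Theory Num.Theory.

Local Open Scope ring_scope.

Fixpoint ackA (k : nat) : nat -> nat :=
  if k is k'.+1 then
    fix f (n : nat) : nat := if n is n'.+1 then ackA k' (f n') else 1%N
  else fun n => (2 * n)%N.

Fixpoint ackB (k : nat) : nat -> nat :=
  if k is k'.+1 then
    fix f (n : nat) : nat := if n is n'.+1 then ackB k' (f n') else 2%N
  else fun n => (n ^ 2)%N.

Lemma ackA_gt (k n : nat) : (0 < n -> n < ackA k n)%N.
Proof.
elim: k n => [|k IHk] n n0; first by rewrite /= mul2n -addnn -addn1 leq_add2l.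
elim: n {n0} => [//|n IHn]; apply: (leq_ltn_trans IHn).
change (ackA k.+1 n.+1) with (ackA k (ackA k.+1 n)).
by apply: IHk; exact: leq_ltn_trans IHn.
Qed.

Lemma ackB_gt (k n : nat) : (1 < n -> n < ackB k n)%N.
Proof.
elim: k n => [|k IHk] n n1; first by rewrite /= -{1}[n]expn1 ltn_exp2l.
suff : (n.+1 < ackB k.+1 n)%N by move/ltnW.
elim: n {n1} => [//|n IHn]; apply: (leq_ltn_trans IHn).
change (ackB k.+1 n.+1) with (ackB k (ackB k.+1 n)).
by apply: IHk; exact: leq_ltn_trans IHn.
Qed.

Lemma ackA_unbounded (k n : nat) : exists s, (n <= ackA k s)%N.
Proof. by exists n.+1; apply/ltnW/ltnW/ackA_gt. Qed.

Lemma ackB_unbounded (k n : nat) : exists s, (n <= ackB k s)%N.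
Proof. by exists n.+2; apply/ltnW/ltnW/ltnW/ackB_gt. Qed.

Definition alpha (k n : nat) : nat :=
  if odd k then ex_minn (ackB_unbounded k./2 n)
  else ex_minn (ackA_unbounded k./2 n).

Definition is_metric (R : realType) (X : finType) (d : X -> X -> R) : Prop :=
  [/\ forall x y, 0 <= d x y,
      forall x y, d x y = 0 <-> x = y,
      forall x y, d x y = d y x &
      forall x y z, d x z <= d x y + d y z].

Record sgraph (X : finType) : Type := SGraph {
  adj :> rel X;
  adj_sym : symmetric adj;
  adj_irr : irreflexive adj }.

(** Each undirected edge is represented once, as the pair whose endpoints are
    in increasing order of [enum_rank]. *)
Definition edges (X : finType) (G : sgraph X) : {set X * X} :=
  [set e | G e.1 e.2 && (enum_rank e.1 < enum_rank e.2)%N].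

Definition nb_edges (X : finType) (G : sgraph X) : nat := #|edges G|.

Definition weight (R : realType) (X : finType) (d : X -> X -> R)
    (G : sgraph X) : R :=
  \sum_(e in edges G) d e.1 e.2.

(** Weight of the walk [u :: p]. *)
Fixpoint walk_weight (R : realType) (X : finType) (d : X -> X -> R)
    (u : X) (p : seq X) : R :=
  if p is v :: q then d u v + walk_weight d v q else 0.

(** Shortest-path distance in [G]; it is [+oo] between distinct components. *)
Definition graph_dist (R : realType) (X : finType) (d : X -> X -> R)
    (G : sgraph X) (u v : X) : \bar R :=
  ereal_inf [set (walk_weight d u p)%:E
            | p in [set p : seq X | path G u p /\ last u p = v]]%classic.

(** The ratios are nonnegative, so the unit [0] of the maximum only matters
    when there is no pair of distinct points. *)
Definition stretch (R : realType) (X : finType) (d : X -> X -> R)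
    (G : sgraph X) : \bar R :=
  \big[maxe/0%E]_(e : X * X | e.1 != e.2)
     (graph_dist d G e.1 e.2 * ((d e.1 e.2)^-1)%:E)%E.

Definition graph_connected (X : finType) (G : sgraph X) : Prop :=
  forall u v, connect G u v.

(** [ucycle] accepts [:: u; v] for an edge [uv], hence the bound on the size. *)
Definition acyclic (X : finType) (G : sgraph X) : Prop :=
  forall c : seq X, (2 < size c)%N -> ~ ucycle G c.

Definition spanning_tree (X : finType) (T : sgraph X) : Prop :=
  graph_connected T /\ acyclic T.

Definition is_mst (R : realType) (X : finType) (d : X -> X -> R)
    (T : sgraph X) : Prop :=
  spanning_tree T /\
  forall T' : sgraph X, spanning_tree T' -> weight d T <= weight d T'.

(** [T] is meant to be a minimum spanning tree of the metric [d]. *)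
Definition lightness (R : realType) (X : finType) (d : X -> X -> R)
    (T G : sgraph X) : R :=
  weight d G / weight d T.

(** [u :: p] is a path from [u] to [v] in [G] with at most [k] edges and weight
    at most [gamma * d u v]. *)
Definition hop_path (R : realType) (X : finType) (d : X -> X -> R)
    (G : sgraph X) (k : nat) (gamma : R) (u v : X) (p : seq X) : Prop :=
  [/\ path G u p, last u p = v, (size p <= k)%N &
      walk_weight d u p <= gamma * d u v].

Definition hop_diameter (R : realType) (X : finType) (d : X -> X -> R)
    (G : sgraph X) (k : nat) (gamma : R) : Prop :=
  forall u v, exists p, hop_path d G k gamma u v p.

(** To a query [(u, v)] the data structure answers with the vertices following
    [u] on a walk starting at [u], in [qtime u v] time units. One time unit
    produces at most one vertex of the answer. *)
Record path_ds (X : finType) : Type := PathDS {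
  answer : X -> X -> seq X;
  qtime : X -> X -> nat;
  size_answer : forall u v, (size (answer u v) <= qtime u v)%N }.

Definition reports_paths (R : realType) (X : finType) (d : X -> X -> R)
    (G : sgraph X) (k : nat) (gamma : R) (tau : nat) (D : path_ds X) : Prop :=
  forall u v, hop_path d G k gamma u v (answer D u v) /\ (qtime D u v <= tau)%N.

(** Registers and memory cells are indexed by, and contain, natural numbers.
    Arithmetic is restricted to addition and truncated subtraction, as usual for
    the unit-cost criterion on unbounded cells. A point [x] of [X] is named by
    the number [enum_rank x]. *)
Inductive cmd : Type :=
| Skip
| Const (r c : nat)
| Add (r r1 r2 : nat)
| Sub (r r1 r2 : nat)
| Fetch (r ra : nat)
| Store (ra r : nat)
| Query (r ra ru rv : nat)
| Seq (c1 c2 : cmd)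
| If (r1 r2 : nat) (c1 c2 : cmd)
| While (r1 r2 : nat) (c : cmd).

Record state : Type := State { reg : nat -> nat; mem : nat -> nat }.

Definition upd (f : nat -> nat) (a v : nat) : nat -> nat :=
  fun i => if i == a then v else f i.

Definition write (f : nat -> nat) (a : nat) (s : seq nat) : nat -> nat :=
  fun i => if (a <= i < a + size s)%N then nth 0%N s (i - a) else f i.

Definition set_reg (s : state) (r v : nat) : state :=
  State (upd (reg s) r v) (mem s).

Definition name (X : finType) (x : X) : nat := enum_rank x.

(** [exec D c s t s']: started in [s], the program [c] halts in [s'] after [t]
    time units; a query costs one unit plus the time spent by [D]. The answer to
    [Query r ra ru rv] is written in memory from address [reg s ra] on, and its
    size in [r]. The tests of [If] and [While] are [reg s r1 < reg s r2]. *)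
Inductive exec (X : finType) (D : path_ds X) :
    cmd -> state -> nat -> state -> Prop :=
| ExecSkip s : exec D Skip s 1 s
| ExecConst r c s : exec D (Const r c) s 1 (set_reg s r c)
| ExecAdd r r1 r2 s :
    exec D (Add r r1 r2) s 1 (set_reg s r (reg s r1 + reg s r2)%N)
| ExecSub r r1 r2 s :
    exec D (Sub r r1 r2) s 1 (set_reg s r (reg s r1 - reg s r2)%N)
| ExecFetch r ra s : exec D (Fetch r ra) s 1 (set_reg s r (mem s (reg s ra)))
| ExecStore ra r s :
    exec D (Store ra r) s 1 (State (reg s) (upd (mem s) (reg s ra) (reg s r)))
| ExecQuery r ra ru rv s u v :
    reg s ru = name u -> reg s rv = name v ->
    exec D (Query r ra ru rv) s (qtime D u v).+1
      (State (upd (reg s) r (size (answer D u v)))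
             (write (mem s) (reg s ra) (map (@name X) (answer D u v))))
| ExecSeq c1 c2 s1 s2 s3 t1 t2 :
    exec D c1 s1 t1 s2 -> exec D c2 s2 t2 s3 ->
    exec D (Seq c1 c2) s1 (t1 + t2)%N s3
| ExecIfT r1 r2 c1 c2 s s' t :
    (reg s r1 < reg s r2)%N -> exec D c1 s t s' ->
    exec D (If r1 r2 c1 c2) s t.+1 s'
| ExecIfF r1 r2 c1 c2 s s' t :
    (reg s r2 <= reg s r1)%N -> exec D c2 s t s' ->
    exec D (If r1 r2 c1 c2) s t.+1 s'
| ExecWhileT r1 r2 c s1 s2 s3 t1 t2 :
    (reg s1 r1 < reg s1 r2)%N -> exec D c s1 t1 s2 ->
    exec D (While r1 r2 c) s2 t2 s3 ->
    exec D (While r1 r2 c) s1 (t1 + t2).+1 s3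
| ExecWhileF r1 r2 c s :
    (reg s r2 <= reg s r1)%N -> exec D (While r1 r2 c) s 1 s.

(** [es] lists every edge of [G] exactly once, in either orientation. *)
Definition edge_list (X : finType) (G : sgraph X) (es : seq (X * X)) : Prop :=
  (forall x y, G x y = ((x, y) \in es) || ((y, x) \in es)) /\
  size es = nb_edges G.

Definition encode (X : finType) (es : seq (X * X)) : seq nat :=
  flatten [seq [:: name e.1; name e.2] | e <- es].

(** Input: the number of points in register 0, the number of listed edges in
    register 1, the edges in memory from address 0 on, and 0 elsewhere. *)
Definition input (X : finType) (es : seq (X * X)) : state :=
  State (fun r => nth 0%N [:: #|X|; size es] r) (fun a => nth 0%N (encode es) a).

(** Output: the number of listed edges in register 0, and the edges in memory
    from the address contained in register 1 on. *)
Definition output (X : finType) (s : state) (es : seq (X * X)) : Prop :=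
  reg s 0%N = size es /\
  forall i, (i < size (encode es))%N ->
    mem s (reg s 1%N + i)%N = nth 0%N (encode es) i.

(* Main.v *)
Require Import Defs.
From mathcomp Require Import all_boot all_order all_algebra.
From mathcomp Require Import all_classical all_reals ereal.
From mathcomp Require Import zify.
Import Order.TTheory GRing.Theory Num.Theory.
Local Open Scope ring_scope.

(* Replace every edge [uv] of [GX] by the path of [Hk] reported for [(u, v)] and
   take the union of these paths. Each edge grows by a factor at most [gamma],
   hence so do the total weight and all distances, and the result is a subgraph
   of [Hk], which bounds the number of its edges.

   The reported paths contain at most [m * tau] edges in total, so the point is
   to remove duplicates in constant time per edge: a matrix of [n * n] marks
   does it. Its rows are addressed without multiplication through a table of the
   [n] row addresses, which takes time [O(n)] to fill; this is affordable since
   finite stretch makes [GX] connected, whence [n <= m + 1]. *)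

(** * Edge lists *)

Section EdgeLists.
Context {X : finType}.
Implicit Types (e f : X * X) (es l out : seq (X * X)) (G H : sgraph X).

(** The representative by which [edges] stores an undirected edge, so that repetition up to
    orientation becomes repetition in [map orient es]. *)
Definition orient e : X * X :=
  if (enum_rank e.1 < enum_rank e.2)%N then e else (e.2, e.1).

Definition joined es x y : bool := ((x, y) \in es) || ((y, x) \in es).

Lemma orient_swap x y : orient (x, y) = orient (y, x).
Proof.
rewrite /orient /=; case: ltngtP => // /ord_inj/enum_rank_inj -> //.
Qed.

Lemma orient_eq e f : orient e = orient f -> f = e \/ f = (e.2, e.1).
Proof.
case: e f => [x y] [z t]; rewrite /orient /=.
by case: ifP; case: ifP => _ _ [-> ->]; [left|right|right|left].
Qed.

Lemma mem_map_orient es x y : (orient (x, y) \in map orient es) = joined es x y.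
Proof.
apply/mapP/orP => [[[z t] ein /orient_eq[] E]|[xy|yx]].
- by left; rewrite -E.
- by right; case: E ein => -> ->.
- by exists (x, y).
- by exists (y, x) => //; rewrite orient_swap.
Qed.

Lemma joinedC es x y : joined es x y = joined es y x.
Proof. by rewrite /joined orbC. Qed.

Lemma map_orient_edges G es :
  (forall x y, G x y = joined es x y) -> map orient es =i edges G.
Proof.
move=> Ges [x y]; rewrite inE /= Ges -mem_map_orient.
apply/mapP/andP => [[[z t] ein xyE]|[/mapP[e ein eE] xy]]; last first.
  by exists e => //; rewrite -eE /orient /= xy.
have := adj_irr G z; have zt : G z t by rewrite Ges /joined ein.
have tz : G t z by rewrite adj_sym.
move: xyE; rewrite /orient /=.
case: ltngtP => /= [lt|lt|/ord_inj/enum_rank_inj zt'] [-> ->].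
- by rewrite lt; split=> //; apply/mapP; exists (z, t); rewrite /orient /= ?lt.
- rewrite lt; split=> //; apply/mapP; exists (z, t) => //.
  by rewrite /orient /= ltnNge (ltnW lt).
- by rewrite -zt' in zt *; rewrite zt.
Qed.

(** The oriented list has the same elements as [edges G], so having the right length amounts to
    having no repetition. Unlike the count, that condition is easy to maintain while a list
    grows. *)
Lemma edge_list_uniq G es :
  edge_list G es <->
  (forall x y, G x y = joined es x y) /\ uniq (map orient es).
Proof.
split=> -[Ges]; last first.
  move=> u; split=> //; rewrite /nb_edges -(eq_card (map_orient_edges _ _ Ges)).
  by rewrite (card_uniqP u) size_map.
rewrite /nb_edges -(eq_card (map_orient_edges _ _ Ges)) => sz; split=> //.
by apply/card_uniqP; rewrite size_map.
Qed.

Lemma weight_edge_list (R : realType) (d : X -> X -> R) G es :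
  (forall x y, d x y = d y x) -> edge_list G es ->
  weight d G = \sum_(e <- es) d e.1 e.2.
Proof.
move=> dC /edge_list_uniq[Ges u]; rewrite /weight.
rewrite -big_enum /=.
have -> : \sum_(e <- es) d e.1 e.2 = \sum_(e <- map orient es) d e.1 e.2.
  by rewrite big_map; apply: eq_bigr => e _; rewrite /orient; case: ifP.
apply/perm_big/uniq_perm => //; first exact: enum_uniq.
by move=> e; rewrite mem_enum (map_orient_edges _ _ Ges).
Qed.

Lemma nb_edges_le G H : (forall x y, G x y -> H x y) ->
  (nb_edges G <= nb_edges H)%N.
Proof.
move=> sub; apply/subset_leq_card/fintype.subsetP => e; rewrite !inE.
by case/andP => /sub -> ->.
Qed.

(** * Insertion of edges without repetition *)

Definition add_edge out e : seq (X * X) :=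
  if joined out e.1 e.2 then out else rcons out e.

(** Model of the list output by the program, whose marks record [joined out]. *)
Definition dedup l : seq (X * X) := foldl add_edge [::] l.

Lemma size_add_edge out e : (size (add_edge out e) <= (size out).+1)%N.
Proof. by rewrite /add_edge; case: ifP; rewrite ?size_rcons. Qed.

Lemma joined_rcons out e x y :
  joined (rcons out e) x y = ((x, y) == e) || ((y, x) == e) || joined out x y.
Proof. by rewrite /joined !mem_rcons !inE orbACA. Qed.

Lemma joined_add_edge out e x y :
  joined (add_edge out e) x y = ((x, y) == e) || ((y, x) == e) || joined out x y.
Proof.
rewrite /add_edge; case: ifP; last by rewrite joined_rcons.
case: e => z t /= zt; apply/esym; case: eqP => [[-> ->]//|_].
by case: eqP => // -[-> ->]; rewrite joinedC.
Qed.

Lemma uniq_add_edge out e :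
  uniq (map orient out) -> uniq (map orient (add_edge out e)).
Proof.
rewrite /add_edge; case: ifP => // ne u; rewrite map_rcons rcons_uniq u andbT.
by case: e ne => x y /=; rewrite mem_map_orient => ->.
Qed.

Lemma joined_dedup l x y : joined (dedup l) x y = joined l x y.
Proof.
elim/last_ind: l => // l e IH; rewrite /dedup -cats1 foldl_cat /=.
by rewrite joined_add_edge -/(dedup l) IH cats1 joined_rcons.
Qed.

Lemma uniq_dedup l : uniq (map orient (dedup l)).
Proof.
elim/last_ind: l => // l e IH; rewrite /dedup -cats1 foldl_cat /=.
exact: uniq_add_edge.
Qed.

Lemma sum_dedup_le (R : realType) (w : X * X -> R) l :
  (forall e, 0 <= w e) -> \sum_(e <- dedup l) w e <= \sum_(e <- l) w e.
Proof.
move=> w0; elim/last_ind: l => // l e IH.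
rewrite /dedup -{1}cats1 foldl_cat /= -/(dedup l) big_rcons /=.
rewrite /add_edge; case: ifP => _; last by rewrite big_rcons /= lerD.
by rewrite -[leLHS]addr0 lerD.
Qed.

Definition walk_edges (u : X) (p : seq X) : seq (X * X) := zip (u :: p) p.

Lemma walk_weightE (R : realType) (d : X -> X -> R) u p :
  walk_weight d u p = \sum_(e <- walk_edges u p) d e.1 e.2.
Proof.
rewrite /walk_edges; elim: p u => [|v p IH] u /=; first by rewrite big_nil.
by rewrite big_cons IH.
Qed.

Lemma path_walk_edges (r : rel X) u p :
  path r u p = all (fun e => r e.1 e.2) (walk_edges u p).
Proof. by rewrite /walk_edges; elim: p u => //= v p IH u; rewrite IH. Qed.

(* Grow a vertex set one vertex, hence at least one inner edge, at a time. *)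
Lemma connected_card G : graph_connected G -> (#|X| <= (nb_edges G).+1)%N.
Proof.
move=> conn; case: (pickP (mem (@predT X))) => [r _|X0]; last first.
  by rewrite (eq_card X0) card0.
pose inside (S : {set X}) := [set e in edges G | (e.1 \in S) && (e.2 \in S)].
suff grow j : (j < #|X|)%N ->
    exists S : {set X}, [/\ r \in S, #|S| = j.+1 & (j <= #|inside S|)%N].
  have X0 : (0 < #|X|)%N by apply/card_gt0P; exists r.
  case: (grow #|X|.-1); first by rewrite prednK.
  move=> S [_ _ le]; rewrite -(prednK X0) ltnS (leq_trans le) //.
  by apply/subset_leq_card/fintype.subsetP => e; rewrite inE => /andP[].
elim: j => [|j IH] jX; first by exists [set r]; rewrite cards1 set11.
have [S [rS cS le]] := IH (ltnW jX).
(* Some edge leaves [S]: otherwise [S] is closed under adjacency, hence all of [X] by connectivity,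
   which contradicts [j.+1 < #|X|]. *)
have [x [y [xS yS Gxy]]] : exists x y, [/\ x \in S, y \notin S & G x y].
  apply: contrapT => none.
  have clS : fingraph.closed G (mem S).
    apply: intro_closed; first by apply: sym_connect_sym; exact: adj_sym.
    move=> x y Gxy xS; apply/negPn/negP => yS; apply: none.
    by exists x, y.
  have : #|S| = #|X|.
    by apply: eq_card => y; rewrite -(closed_connect clS (conn r y)) rS inE.
  by rewrite cS => E; rewrite E ltnn in jX.
exists (y |: S); split; first by rewrite !inE rS orbT.
  by rewrite cardsU1 yS cS.
have Gyx : G y x by rewrite adj_sym.
have oin : orient (x, y) \in edges G.
  rewrite inE /orient /=; case: ltngtP => /= [lt|lt|/ord_inj/enum_rank_inj E].
  - by rewrite Gxy.
  - by rewrite Gyx.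
  - by rewrite E (negPf yS) in xS.
have nin : orient (x, y) \notin inside S.
  by rewrite inE oin /orient; case: ifP; rewrite /= (negPf yS) ?andbF.
apply: (@leq_trans #|orient (x, y) |: inside S|).
  by rewrite cardsU1 nin.
apply/subset_leq_card/fintype.subsetP => e; rewrite !inE => /orP[/eqP->|].
  move: oin; rewrite inE => ->.
  by rewrite /orient; case: ifP; rewrite /= !eqxx xS ?orbT.
by case/andP => -> /andP[-> ->]; rewrite !orbT.
Qed.

End EdgeLists.

(** * Distances after replacing edges by walks *)

Section Metric.
Context {R : realType} {X : finType} {d : X -> X -> R}.
Hypothesis dm : is_metric d.
Implicit Types G H : sgraph X.

Let d_ge0 x y : 0 <= d x y. Proof. by case: dm. Qed.
Let dC x y : d x y = d y x. Proof. by case: dm. Qed.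

Lemma metric_gt0 x y : x != y -> 0 < d x y.
Proof.
have [_ d0 _ _] := dm; move=> xy; rewrite lt_neqAle d_ge0 andbT eq_sym.
by apply: contra xy => /eqP/d0 ->.
Qed.

Lemma weight_ge0 G : 0 <= weight d G.
Proof. exact: sumr_ge0. Qed.

Lemma walk_weight_cat u p q :
  walk_weight d u (p ++ q) = walk_weight d u p + walk_weight d (last u p) q.
Proof. by elim: p u => [|v p IH] u /=; rewrite ?add0r // IH addrA. Qed.

Lemma walk_weight_rev u p :
  walk_weight d (last u p) (rev (belast u p)) = walk_weight d u p.
Proof.
elim: p u => // v p IH u /=; rewrite rev_cons -cats1 walk_weight_cat IH /=.
rewrite addr0 addrC; congr (_ + _); rewrite dC.
by case: p {IH} => [|w p]; rewrite /= ?rev_cons ?last_rcons.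
Qed.

Lemma stretch_ge0 G : (0 <= stretch d G)%E.
Proof. exact: bigmax_ge_id. Qed.

(** The conjunct [0 <= b] comes from the unit of the maximum, and is all that remains when there are
    no two distinct points. *)
Lemma stretch_leP G (b : R) :
  (stretch d G <= b%:E)%E <->
  0 <= b /\ forall x y, x != y -> (graph_dist d G x y <= (b * d x y)%:E)%E.
Proof.
have E x y : x != y -> (graph_dist d G x y * ((d x y)^-1)%:E <= b%:E)%E =
    (graph_dist d G x y <= (b * d x y)%:E)%E.
  by move=> xy; rewrite lee_pdivrMr ?EFinM // metric_gt0.
split=> [st|[b0 dist]].
  split=> [|x y xy]; first by rewrite -lee_fin (le_trans (stretch_ge0 G)).
  rewrite -E //; apply: le_trans st.
  pose ratio (e : X * X) := (graph_dist d G e.1 e.2 * ((d e.1 e.2)^-1)%:E)%E.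
  exact: (le_bigmax_cond _ ratio (j := (x, y))).
by apply: bigmax_le => [|[x y] xy]; rewrite ?lee_fin // E ?dist.
Qed.

(** Between distinct components the infimum is over the empty set, so the distance is [+oo] and no
    real number bounds it. *)
Lemma stretch_connected G (b : R) :
  (stretch d G <= b%:E)%E -> graph_connected G.
Proof.
move/stretch_leP => [_ dist] u v; have [->//|uv] := eqVneq u v.
apply: contrapT => nc; have := dist _ _ uv.
suff -> : graph_dist d G u v = +oo%E by [].
rewrite /graph_dist -[RHS]ereal_inf0; congr ereal_inf.
apply/seteqP; split=> // z [p [Gp pv] _] /=; apply: nc.
by apply/connectP; exists p.
Qed.

Lemma graph_dist_le G u p :
  path G u p -> (graph_dist d G u (last u p) <= (walk_weight d u p)%:E)%E.
Proof. by move=> Gp; apply: ereal_inf_lbound; exists p. Qed.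

Lemma replace_walk G H (g : R) :
  (forall u v, G u v ->
     exists2 p, path H u p /\ last u p = v & walk_weight d u p <= g * d u v) ->
  forall u p, path G u p ->
  exists2 q, path H u q /\ last u q = last u p &
    walk_weight d u q <= g * walk_weight d u p.
Proof.
move=> rep u p; elim: p u => [|v p IH] u /=; first by exists [::]; rewrite ?mulr0.
case/andP => /rep[q [Hq qv] wq] /IH[q' [Hq' q'l] wq'].
exists (q ++ q'); first by rewrite cat_path last_cat qv Hq.
by rewrite walk_weight_cat qv mulrDr lerD.
Qed.

Lemma stretch_replace G H (g b : R) :
  0 <= g ->
  (forall u v, G u v ->
     exists2 p, path H u p /\ last u p = v & walk_weight d u p <= g * d u v) ->
  (stretch d G <= b%:E)%E -> (stretch d H <= (g * b)%:E)%E.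
Proof.
move=> g0 rep st; have conn := stretch_connected _ _ st.
have /stretch_leP[b0 dist] := st.
apply/stretch_leP; split=> [|x y xy]; first exact: mulr_ge0.
have walk p : path G x p -> last x p = y ->
    (graph_dist d H x y <= (g * walk_weight d x p)%:E)%E.
  move=> Gp py; have [q [Hq qy] wq] := replace_walk _ _ _ rep _ _ Gp.
  by rewrite -py -qy (le_trans (graph_dist_le _ _ _ Hq)).
have /connectP[p0 Gp0 y0] := conn x y.
(* Moving [g] across the infimum needs division by [g]; for [g = 0] any single walk already gives
   the bound. *)
move: g0; rewrite le_eqVlt => /predU1P[g0|g0].
  by have := walk _ Gp0 (esym y0); rewrite -g0 !mul0r.
have := dist _ _ xy; rewrite -mulrA [in X in _ -> X]EFinM -lee_pdivrMl //.
apply: le_trans; apply: le_ereal_inf_tmp => _ [p [Gp py] <-].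
by rewrite lee_pdivrMl // -EFinM walk.
Qed.

End Metric.

(** * The program *)

Fixpoint seqc (cs : seq cmd) : cmd :=
  if cs is c :: cs' then (if cs' is [::] then c else Seq c (seqc cs')) else Skip.

(* Registers: 0 number of points, then of output edges; 1 number of input edges,
   then output address; 2 the constant 1; 3 end of the input, where the table of
   row addresses starts; 4 next row, then end of the output; 5 loop counter;
   7 and 8 current edge; 6 and 13 addresses of its two marks; 10 and 11 bounds
   of the unread part of the answer. *)
Definition init_rows : cmd :=
  While 5 0 (seqc [:: Add 6 3 5; Store 6 4; Add 4 4 0; Add 5 5 2]).

(** Marks are kept symmetric: one is tested, both are set. The closing [Add 7 8 12] copies register
    8, making the vertex just read the start of the next edge. *)
Definition visit_vertex : cmd :=
  seqc [:: Fetch 8 10;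
           Add 6 3 7; Fetch 6 6; Add 6 6 8;
           Add 13 3 8; Fetch 13 13; Add 13 13 7;
           Fetch 12 6;
           If 12 2 (seqc [:: Store 6 2; Store 13 2;
                             Store 4 7; Add 4 4 2; Store 4 8; Add 4 4 2;
                             Add 0 0 2]) Skip;
           Const 12 0; Add 7 8 12; Add 10 10 2].

Definition visit_walk : cmd := While 10 11 visit_vertex.

(* The first query only serves to learn the size [q] of the answer: the second
   one writes it [2 * q] cells further, out of reach of the output. *)
Definition replace_edge : cmd :=
  seqc [:: Fetch 7 5; Add 5 5 2; Fetch 8 5; Add 5 5 2;
           Query 9 4 7 8; Add 10 4 9; Add 10 10 9;
           Query 9 10 7 8; Add 11 10 9; visit_walk].

Definition replace_edges : cmd := While 5 3 replace_edge.

(** Memory past the input is 0, so the matrix starts unmarked and only the table of row addresses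
    has to be filled. *)
Definition sparsify : cmd :=
  seqc [:: Const 2 1; Add 3 1 1; Add 4 3 0; Const 5 0; init_rows;
           Const 0 0; Add 1 4 0; Const 5 0; replace_edges].

Section Program.
Local Open Scope nat_scope.
Context {X : finType} (D : path_ds X) (es : seq (X * X)).
Implicit Types (s : state) (out l rest : seq (X * X)) (u v x y : X).

(** * Total correctness with time bounds *)

Definition runs (c : cmd) s (b : nat) (Q : state -> Prop) : Prop :=
  exists t s', [/\ exec D c s t s', t <= b & Q s'].

Lemma runs_weaken c s b b' (Q : state -> Prop) :
  runs c s b Q -> b <= b' -> runs c s b' Q.
Proof.
move=> [t [s' [ex tb Qs']]] bb'; exists t, s'; split=> //; exact: leq_trans bb'.
Qed.

Lemma runs_exec c s t s' (Q : state -> Prop) :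
  exec D c s t s' -> Q s' -> runs c s t Q.
Proof. by exists t, s'. Qed.

Lemma runs_seq c c' s b b' (Q Q' : state -> Prop) :
  runs c s b Q -> (forall s1, Q s1 -> runs c' s1 b' Q') ->
  runs (Seq c c') s (b + b') Q'.
Proof.
move=> [t [s1 [ex tb Qs1]]] /(_ _ Qs1)[t' [s' [ex' tb' Qs']]].
by exists (t + t'), s'; split; [exact: ExecSeq ex ex'|exact: leq_add|].
Qed.

Lemma runs_step c c' s t s1 b (Q : state -> Prop) :
  exec D c s t s1 -> runs c' s1 b Q -> runs (Seq c c') s (t + b) Q.
Proof.
move=> ex run; apply: (@runs_seq _ _ _ _ _ (eq s1)); first exact: runs_exec ex _.
by move=> _ <-.
Qed.

Lemma runs_while r1 r2 c s b b' (Q Q' : state -> Prop) :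
  reg s r1 < reg s r2 -> runs c s b Q ->
  (forall s1, Q s1 -> runs (While r1 r2 c) s1 b' Q') ->
  runs (While r1 r2 c) s (b + b').+1 Q'.
Proof.
move=> lt [t [s1 [ex tb Qs1]]] /(_ _ Qs1)[t' [s' [ex' tb' Qs']]].
exists (t + t').+1, s'; split=> //; first exact: ExecWhileT ex ex'.
by rewrite ltnS leq_add.
Qed.

(* Without simplification at each step the size of the symbolic state is
   exponential in the number of instructions. *)
Arguments upd _ _ _ _ /.
Local Ltac step := eapply runs_step; [by constructor|rewrite /=].

(** * Memory layout and loop invariant *)

Lemma encode_cat l l' : encode (l ++ l') = encode l ++ encode l'.
Proof. by rewrite /encode map_cat flatten_cat. Qed.

Lemma encode_cons (e : X * X) l :
  encode (e :: l) = [:: name e.1, name e.2 & encode l].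
Proof. by []. Qed.

Lemma size_encode l : size (encode l) = 2 * size l.
Proof. by elim: l => // e l IH; rewrite encode_cons /= IH mulnS. Qed.

Lemma name_lt x : name x < #|X|.
Proof. exact: ltn_ord. Qed.

(* Memory holds, in this order, the input, the table of row addresses, the
   matrix of marks, the output and the answer to the last query. *)
Definition rows : nat := 2 * size es.
Definition marks : nat := rows + #|X|.
Definition mark x y : nat := marks + name x * #|X| + name y.
Definition outputs : nat := marks + #|X| * #|X|.

Lemma row_lt x : rows + name x < marks.
Proof. by rewrite ltn_add2l name_lt. Qed.

Lemma rows_le : rows <= marks. Proof. exact: leq_addr. Qed.

Lemma mark_ge x y : marks <= mark x y.
Proof. by rewrite /mark -addnA leq_addr. Qed.

Lemma mark_lt x y : mark x y < outputs.
Proof.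
have := name_lt x; have := name_lt y; rewrite /mark /outputs => ? ?.
by rewrite -addnA ltn_add2l; nia.
Qed.

(** Past the offset [marks], an address has digits [name x] and [name y] in base [#|X|]. *)
Lemma mark_inj x y x' y' : mark x y = mark x' y' -> (x, y) = (x', y').
Proof.
move/eqP; rewrite /mark -!(addnA marks) eqn_add2l => /eqP E.
have yl := name_lt y; have yl' := name_lt y'.
have X0 : 0 < #|X| by exact: leq_ltn_trans yl.
have ny : name y = name y'.
  by move: (congr1 (modn^~ #|X|) E); rewrite /= !modnMDl !modn_small.
have nx : name x = name x'.
  by move/eqP: E; rewrite ny eqn_add2r eqn_pmul2r // => /eqP.
by move/ord_inj/enum_rank_inj: nx => ->; move/ord_inj/enum_rank_inj: ny => ->.
Qed.

(** Invariant of the main loop: the matrix is the adjacency matrix of [out]. Cells beyond the output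
    are left free, since answers are written there. *)
Record holds out s : Prop := Holds {
  holds0 : reg s 0 = size out;
  holds1 : reg s 1 = outputs;
  holds2 : reg s 2 = 1;
  holds3 : reg s 3 = rows;
  holds4 : reg s 4 = outputs + 2 * size out;
  holds_input : forall i, i < rows -> Defs.mem s i = nth 0 (encode es) i;
  holds_row : forall x, Defs.mem s (rows + name x) = marks + name x * #|X|;
  holds_mark : forall x y, Defs.mem s (mark x y) = joined out x y;
  holds_output : forall i, i < 2 * size out ->
    Defs.mem s (outputs + i) = nth 0 (encode out) i }.

Lemma holds_ext out s s' :
  holds out s -> {in iota 0 5, reg s' =1 reg s} ->
  (forall a, a < outputs + 2 * size out -> Defs.mem s' a = Defs.mem s a) ->
  holds out s'.
Proof.
case=> s0 s1 s2 s3 s4 si sr sm so rE mE.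
have le := rows_le; have le' : marks <= outputs by rewrite leq_addr.
split; rewrite ?rE //.
- by move=> i ir; rewrite mE ?si //; lia.
- by move=> x; have := row_lt x => ?; rewrite mE ?sr //; lia.
- by move=> x y; have := mark_lt x y => ?; rewrite mE ?sm //; lia.
- by move=> i io; rewrite mE ?so //; lia.
Qed.

(** The bound 19 is reached when an edge is output: 11 instructions outside the test, 1 unit for the
    test and 7 instructions under it. The last clause excepts the two cells that this edge may
    take. *)
Lemma visit_vertexP out s u v :
  holds out s -> reg s 7 = name u -> Defs.mem s (reg s 10) = name v ->
  runs visit_vertex s 19 (fun s' => holds (add_edge out (u, v)) s' /\
    [/\ reg s' 5 = reg s 5, reg s' 7 = name v, reg s' 10 = (reg s 10).+1,
        reg s' 11 = reg s 11 &
        forall a, outputs + 2 * size out + 2 <= a ->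
          Defs.mem s' a = Defs.mem s a]).
Proof.
case=> s0 s1 s2 s3 s4 si sr sm so s7 sv.
have uvE : Defs.mem s (reg s 3 + reg s 7) + Defs.mem s (reg s 10) = mark u v.
  by rewrite s3 s7 sv sr.
have vuE : Defs.mem s (reg s 3 + Defs.mem s (reg s 10)) + reg s 7 = mark v u.
  by rewrite s3 s7 sv sr.
have le := rows_le; have le' : marks <= outputs by rewrite leq_addr.
case: (boolP (joined out u v)) => [uv|nuv]; eapply runs_weaken.
- do 8 step; rewrite uvE vuE sm sv.
  eapply runs_step.
    by apply: ExecIfF; [rewrite /= s2 uv|constructor].
  do 2 step.
  eapply runs_exec; first by constructor.
  split; first by rewrite /add_edge /= uv; split.
  by rewrite /= s2 addn0 addn1.
- by [].
- do 8 step; rewrite uvE vuE sm sv.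
  eapply runs_step.
    apply: ExecIfT; first by rewrite /= s2 (negPf nuv).
    by do 6 (eapply ExecSeq; [by constructor|rewrite /=]); constructor.
  do 2 step.
  eapply runs_exec; first by constructor.
  have uvlt := mark_lt u v; have vult := mark_lt v u.
  have uvge := mark_ge u v; have vuge := mark_ge v u.
  split; last first.
    rewrite /= ?uvE ?vuE ?s2 ?s4 addn0 addn1; split=> // a ale.
    by rewrite !ifF //; lia.
  rewrite /add_edge /= (negPf nuv).
  split; rewrite /= ?uvE ?vuE ?s0 ?s2 ?s3 ?s4 ?s7 ?sv ?size_rcons //.
  + by rewrite addn1.
  + by rewrite mulnS; lia.
  + by move=> i ir; rewrite !ifF ?si //; lia.
  + by move=> x; have := row_lt x => ?; rewrite !ifF ?sr //; lia.
  + move=> x y; have := mark_lt x y => ?.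
    rewrite ifF; last lia.
    rewrite ifF; last lia.
    rewrite joined_rcons; case: eqP => [/mark_inj[-> ->]|vu].
      by rewrite eqxx orbT.
    case: eqP => [/mark_inj[-> ->]|uv]; first by rewrite eqxx.
    rewrite sm; case: eqP => [[xu yv]|_]; first by case: uv; rewrite xu yv.
    by case: eqP => [[yu xv]|//]; case: vu; rewrite xv yu.
  + move=> i ilt; rewrite -cats1 encode_cat nth_cat size_encode.
    have [io|io] := ltnP i (2 * size out).
      by rewrite !ifF ?so //; lia.
    have [->|ne] := eqVneq i (2 * size out).
      by rewrite subnn ifF ?eqxx //; lia.
    have -> : i = (2 * size out).+1 by lia.
    by rewrite subSnn addnS addn1 eqxx.
- by [].
Qed.

(** The output grows by at most two cells per vertex read, so a gap of [2 * size p] cells keeps it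
    from overwriting the unread vertices. Each vertex costs 19 units and a loop test. *)
Lemma visit_walkP p out s u :
  holds out s -> reg s 7 = name u ->
  outputs + 2 * size out + 2 * size p <= reg s 10 ->
  reg s 11 = reg s 10 + size p ->
  (forall i, i < size p ->
    Defs.mem s (reg s 10 + i) = nth 0 (map (@name X) p) i) ->
  runs visit_walk s (20 * size p + 1) (fun s' =>
    holds (foldl (@add_edge X) out (walk_edges u p)) s' /\ reg s' 5 = reg s 5).
Proof.
elim: p out s u => [|v p IH] out s u hs s7 room s11 buf.
  by apply: (@runs_exec _ _ _ s) => //; apply: ExecWhileF; rewrite s11 addn0.
have szo := size_add_edge out (u, v).
move: room s11 buf => /= room s11 buf.
eapply runs_weaken.
  eapply runs_while; first by rewrite s11; lia.
    by apply: (visit_vertexP out s u v); rewrite // -[reg s 10]addn0 buf.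
  move=> s1 [hs1 [<- s17 s110 s111 mE]]; apply: IH => //.
  - by rewrite s110; lia.
  - by rewrite s111 s110 s11 addnS addSn.
  - by move=> i ip; rewrite s110 addSnnS mE ?buf //; lia.
by lia.
Qed.

Definition walks l : seq (X * X) :=
  flatten [seq walk_edges e.1 (answer D e.1 e.2) | e <- l].

(** Each of the two queries costs [qtime + 1], the walk at most [20 * qtime + 1] by [size_answer],
    and the other instructions 7. *)
Lemma replace_edgeP pre (e : X * X) rest out s :
  es = pre ++ e :: rest -> holds out s -> reg s 5 = 2 * size pre ->
  runs replace_edge s (22 * qtime D e.1 e.2 + 10) (fun s' =>
    holds (foldl (@add_edge X) out (walk_edges e.1 (answer D e.1 e.2))) s' /\
    reg s' 5 = 2 * (size pre).+1).
Proof.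
move=> esE hs s5; have [_ _ s2 s3 s4 si _ _ _] := hs.
have lt : 2 * size pre + 1 < rows by rewrite /rows esE size_cat /=; lia.
have u_in : Defs.mem s (2 * size pre) = name e.1.
  by rewrite si ?esE ?encode_cat ?nth_cat ?size_encode ?ltnn ?subnn //; lia.
have v_in : Defs.mem s (2 * size pre + 1) = name e.2.
  rewrite si // esE encode_cat nth_cat size_encode ifF; last lia.
  by rewrite addnC addnK.
have aq := size_answer D e.1 e.2.
eapply runs_weaken.
  do 4 step.
  eapply runs_step.
    by apply: (@ExecQuery _ _ _ _ _ _ _ e.1 e.2); rewrite /= s5 ?s2.
  do 2 step.
  eapply runs_step.
    by apply: (@ExecQuery _ _ _ _ _ _ _ e.1 e.2); rewrite /= s5 ?s2.
  step.
  have post s1 : reg s1 5 = 2 * (size pre).+1 ->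
    runs visit_walk s1 (20 * size (answer D e.1 e.2) + 1) (fun s' =>
      holds (foldl (@add_edge X) out (walk_edges e.1 (answer D e.1 e.2))) s' /\
      reg s' 5 = reg s1 5) ->
    runs visit_walk s1 (20 * size (answer D e.1 e.2) + 1) (fun s' =>
      holds (foldl (@add_edge X) out (walk_edges e.1 (answer D e.1 e.2))) s' /\
      reg s' 5 = 2 * (size pre).+1) by move=> ->.
  apply: post; first by rewrite /= s2 s5; lia.
  apply: visit_walkP.
  - apply: (holds_ext out s) => // [i|i io].
      by rewrite mem_iota; case: i => [|[|[|[|[]]]]].
    by rewrite /= s4 /write !ifF //; lia.
  - by rewrite /= s5.
  - by rewrite /= s4; lia.
  - by [].
  - move=> i ia; rewrite /= /write size_map ifT; last lia.
    by rewrite addKn.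
by lia.
Qed.

Lemma replace_edgesP pre rest s :
  es = pre ++ rest -> holds (dedup (walks pre)) s -> reg s 5 = 2 * size pre ->
  runs replace_edges s (\sum_(e <- rest) (22 * qtime D e.1 e.2 + 11) + 1)
    (holds (dedup (walks es))).
Proof.
elim: rest pre s => [|e rest IH] pre s esE hs s5.
  rewrite big_nil; apply: (@runs_exec _ _ _ s); last by rewrite esE cats0.
  by apply: ExecWhileF; rewrite (holds3 _ _ hs) s5 /rows esE cats0.
eapply runs_weaken.
  eapply runs_while.
  - by rewrite (holds3 _ _ hs) s5 /rows esE size_cat /=; lia.
  - exact: replace_edgeP esE hs s5.
  - move=> s1 [hs1 s15]; apply: (IH (rcons pre e)); last by rewrite size_rcons.
      by rewrite cat_rcons.
    by rewrite /walks map_rcons flatten_rcons /dedup foldl_cat; exact: hs1.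
by rewrite big_cons; lia.
Qed.

(** Here [i] rows are entered and [j] remain, each costing four instructions and a loop test. *)
Lemma init_rowsP j i s : i + j = #|X| ->
  reg s 0 = #|X| -> reg s 2 = 1 -> reg s 3 = rows -> reg s 5 = i ->
  reg s 4 = marks + i * #|X| ->
  (forall a, a < i -> Defs.mem s (rows + a) = marks + a * #|X|) ->
  (forall a, a < rows -> Defs.mem s a = nth 0 (encode es) a) ->
  (forall a, marks <= a -> Defs.mem s a = 0) ->
  runs init_rows s (5 * j + 1) (fun s' =>
    [/\ reg s' 2 = 1, reg s' 3 = rows, reg s' 4 = outputs,
     forall a, a < #|X| -> Defs.mem s' (rows + a) = marks + a * #|X| &
     (forall a, a < rows -> Defs.mem s' a = nth 0 (encode es) a) /\
     (forall a, marks <= a -> Defs.mem s' a = 0)]).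
Proof.
elim: j i s => [|j IH] i s ij s0 s2 s3 s5 s4 row inp zero.
  rewrite addn0 in ij; apply: (@runs_exec _ _ _ s).
    by apply: ExecWhileF; rewrite s0 s5 ij.
  by rewrite s2 s3 s4 ij; split=> // a aX; apply: row; rewrite ij.
have lt : i < #|X| by lia.
eapply runs_weaken.
  eapply (@runs_while _ _ _ _ _ _ (eq _)); first by rewrite s0 s5.
    do 3 step.
    by eapply runs_exec; first by constructor.
  move=> _ <-; apply: (IH i.+1); rewrite /= ?s0 ?s2 ?s3 ?s4 ?s5 //.
  - by rewrite addSnnS.
  - by rewrite addn1.
  - by rewrite mulSnr addnA.
  - move=> a ai; case: eqP => [/addnI->//|ne]; apply: row; lia.
  - by move=> a ar; rewrite ifF ?inp //; lia.
  - by move=> a am; rewrite ifF ?zero //; move: am; rewrite /marks; lia.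
by lia.
Qed.

Lemma sparsifyP :
  runs sparsify (input es)
    (5 * #|X| + \sum_(e <- es) (22 * qtime D e.1 e.2 + 11) + 9)
    (holds (dedup (walks es))).
Proof.
eapply runs_weaken.
  do 4 step.
  eapply runs_seq.
    apply: (init_rowsP #|X| 0); rewrite //=.
    - by rewrite addnn -mul2n.
    - by rewrite addnn -mul2n mul0n addn0.
    - by move=> a am; rewrite nth_default // size_encode (leq_trans _ am) ?rows_le.
  move=> s [s2 s3 s4 row [inp zero]].
  do 3 step.
  apply: (replace_edgesP [::]) => //.
  split; rewrite /= ?s4 ?addn0 ?muln0 //.
  - by move=> x; rewrite row // name_lt.
  - by move=> x y; rewrite zero // mark_ge.
by lia.
Qed.

Lemma holds_outputP out s : holds out s -> output s out.
Proof.
case=> s0 s1 _ _ _ _ _ _ so; split=> // i; rewrite size_encode s1; exact: so.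
Qed.

End Program.

(** * Time, stretch, lightness and size of the new spanner *)

Theorem theorem5p2 (R : realType) :
  exists (P : cmd) (c : nat),
  forall C : R, exists C' : R,
  forall (n : nat) (X : finType) (d : X -> X -> R) (MST : sgraph X)
         (k m : nat) (beta L gamma zeta : R) (tau : nat)
         (GX Hk : sgraph X) (DX : path_ds X),
    #|X| = n -> is_metric d -> is_mst d MST ->
    (2 <= k)%N ->
    nb_edges GX = m ->
    (stretch d GX <= beta%:E)%E ->
    lightness d MST GX <= L ->
    (stretch d Hk <= gamma%:E)%E ->
    hop_diameter d Hk k gamma ->
    (nb_edges Hk)%:R <= C * (n%:R * (alpha k n)%:R * zeta) ->
    reports_paths d Hk k gamma tau DX ->
  forall es : seq (X * X), edge_list GX es ->
  exists (GX' : sgraph X) (es' : seq (X * X)) (t : nat) (s : state),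
    [/\ exec DX P (input es) t s,
        (t <= c * maxn 1 (m * tau))%N,
        output s es' /\ edge_list GX' es' &
        [/\ (stretch d GX' <= (gamma * beta)%:E)%E,
            lightness d MST GX' <= gamma * L &
            (nb_edges GX')%:R <= C' * (n%:R * (alpha k n)%:R * zeta)]].
Proof.
(* The time is at most [5 * (m + 1) + 33 * (m * tau) + 9], and 52 = 5 + 5 + 33 + 9. The size
   constant is kept because the result is a subgraph of [Hk]. *)
exists sparsify, 52%N => C; exists C.
move=> n X d MST k m beta L gamma zeta tau GX Hk DX nX dm mst k2 mE stG liG stH hop cH rep es esG.
have [dge0 d0 dC _] := dm; have [GXes szes] := esG.
have /(stretch_leP dm)[g0 _] := stH.
have subH x y : joined (walks DX es) x y -> Hk x y.
  have sub z t : (z, t) \in walks DX es -> Hk z t.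
    case/flattenP => l /mapP[e ein ->] zt.
    have [[+ _ _ _] _] := rep e.1 e.2.
    by rewrite path_walk_edges => /allP/(_ _ zt).
  by case/orP => /sub //; rewrite adj_sym.
have irr : irreflexive (joined (walks DX es)).
  by move=> x; apply/negP => /subH; rewrite adj_irr.
pose GX' := @SGraph X (joined (walks DX es)) (joinedC _) irr.
have esG' : edge_list GX' (dedup (walks DX es)).
  apply/edge_list_uniq; split=> [x y|]; last exact: uniq_dedup.
  by rewrite joined_dedup.
have [t [s [ex tle hs]]] := sparsifyP DX es.
exists GX', (dedup (walks DX es)), t, s; split=> //.
- have connX := connected_card _ (stretch_connected dm _ _ stG).
  (* The ends of an edge differ, so its answer is nonempty and takes time at least 1; this absorbs
     the additive 11 into [33 * tau]. *)
  have qtime_bounds e : e \in es -> (0 < qtime DX e.1 e.2 <= tau)%N.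
    case: e => u v uvin /=; have [[_ last_v _ _] ->] := rep u v; rewrite andbT.
    apply: leq_trans (size_answer DX u v).
    rewrite lt0n size_eq0; apply/eqP => a0; rewrite a0 /= in last_v.
    by have := adj_irr GX v; rewrite GXes -{1}last_v uvin.
  have sum_le : (\sum_(e <- es) (22 * qtime DX e.1 e.2 + 11) <= 33 * (m * tau))%N.
    rewrite -mE -szes mulnCA big_seq -sum1_size big_distrl /= [leqRHS]big_seq.
    by apply: leq_sum => e /qtime_bounds/andP[q0 qt];
      move: (qtime DX e.1 e.2) q0 qt => q; lia.
  apply: (leq_trans tle); rewrite mE in connX.
  (* Without edges there is at most one point, and the time is bounded by a constant thanks to
     [maxn 1]. *)
  have [m0|m0] := posnP m; first by move: sum_le; rewrite m0; lia.
  have tau0 : (0 < tau)%N.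
    have /hasP[e /qtime_bounds/andP[q0 qt] _] : has predT es.
      by rewrite has_predT szes mE.
    exact: leq_trans qt.
  have : (m <= m * tau)%N by exact: leq_pmulr.
  by lia.
- split=> //; exact: holds_outputP hs.
- split.
  + apply: (stretch_replace dm GX) stG => // u v.
    have inG' e : e \in es -> path GX' e.1 (answer DX e.1 e.2).
      move=> ein; rewrite path_walk_edges; apply/allP => -[x y] xy /=.
      apply/orP; left; apply/flattenP.
      exists (walk_edges e.1 (answer DX e.1 e.2)) => //.
      by apply/mapP; exists e.
    rewrite GXes => /orP[/inG'|/inG'] /= Gp.
      by have [[_ lst _ w] _] := rep u v; exists (answer DX u v).
    (* The edge is listed as [(v, u)], so its reported path is traversed backwards. *)
    have [[_ lst _ w] _] := rep v u.
    exists (rev (belast v (answer DX v u))); last first.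
      by rewrite -{1}lst walk_weight_rev // dC.
    split; last first.
      by case: (answer DX v u) lst => //= x p _; rewrite rev_cons last_rcons.
    rewrite -{1}lst rev_path; apply: etrans Gp.
    by apply: eq_path => x y; exact: joinedC.
  + rewrite /lightness.
    apply: (@le_trans _ _ (gamma * (weight d GX / weight d MST))).
      rewrite mulrA ler_wpM2r // ?invr_ge0 ?weight_ge0 //.
      rewrite (weight_edge_list _ _ _ _ dC esG') (weight_edge_list _ _ _ _ dC esG).
      apply: (le_trans (sum_dedup_le _ _ _ _)) => //.
      rewrite big_flatten big_map mulr_sumr; apply: ler_sum => e _.
      by rewrite -walk_weightE; have [[]] := rep e.1 e.2.
    exact: ler_wpM2l.
  + apply: le_trans cH; rewrite ler_nat; exact: nb_edges_le.
Qed.
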